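(* Let $(x_n)_{n\ge 1}$ be a sequence of positive real numbers with $\sum_{n=1}^{\infty} x_n<\infty$. For $m\in\mathbb{N}$ let $$E_m(x)=\left\{\sum_{i=1}^{\infty}\epsilon_i x_i \;:\; \epsilon_i\in\{0,1,2,\ldots,m\}\text{ for all } i\in\mathbb{N}\right\}.$$ Then for every $m\in\mathbb{N}$, $E_m(x)$ is homeomorphic to one of the following: (1) a Cantor set; (2) a finite union of intervals; (3) a Cantorval.
   Context: Let $K\subset\mathbb{R}$ be compact. A gap of $K$ is a bounded connected component of $\mathbb{R}\setminus K$; an interval of $K$ is a non-trivial (non-degenerate) connected component of $K$. A perfect subset of $\mathbb{R}$ in which every gap is accumulated on each side by infinitely many intervals and gaps of the set is called an M-Cantorval. A perfect subset of $\mathbb{R}$ in which every gap has an interval adjacent to it on its right and is accumulated on its left by infinitely many intervals and gaps is called an L-Cantorval; an R-Cantorval is defined analogously with left and right interchanged. A Cantorval is an M-, L- or R-Cantorval. A Cantor set means a set homeomorphic to the standard middle-thirds Cantor set. *)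

(* Defs.v *)
From HB Require Import structures.
From mathcomp Require Import all_boot all_order all_algebra.
From mathcomp Require Import all_classical all_reals all_analysis.
Set Implicit Arguments. Unset Strict Implicit. Unset Printing Implicit Defensive.
Import Order.TTheory GRing.Theory Num.Theory.
Import numFieldNormedType.Exports.
Local Open Scope classical_set_scope.
Local Open Scope ring_scope.

Section Defs.
Variable R : realType.

(* E_m(x) = { sum_i eps_i x_i : eps_i in {0,..,m} }  (sequence indexed from 0) *)
Definition Em (m : nat) (x : R ^nat) : set R :=
  [set y | exists eps : nat -> nat, (forall i, (eps i <= m)%N) /\
       y = limn (series (fun i => (eps i)%:R * x i))].

Definition homeomorphic (A B : set R) : Prop :=
  exists (f g : R -> R),
    [/\ f @` A `<=` B, g @` B `<=` A,
        (forall a, A a -> g (f a) = a), (forall b, B b -> f (g b) = b) &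
        ({within A, continuous f} /\ {within B, continuous g})].

Definition middle_thirds_cantor : set R :=
  [set y : R | exists d : nat -> bool,
      y = limn (series (fun i => (2 * (d i)%:R) / 3 ^+ i.+1 : R))].

Definition cantor_set (A : set R) : Prop := homeomorphic A middle_thirds_cantor.

Definition gap (K G : set R) : Prop :=
  (exists x, ~ K x /\ G = connected_component (~` K) x) /\ bounded_set G.

Definition interval_of (K I : set R) : Prop :=
  (exists x, K x /\ I = connected_component K x) /\
  (exists y z, I y /\ I z /\ y != z).

Definition acc_left (K : set R) (a : R) : Prop :=
  forall e : R, 0 < e ->
    ~ finite_set [set I | interval_of K I /\ I `<=` `]a - e, a[] /\
    ~ finite_set [set G | gap K G /\ G `<=` `]a - e, a[].
Definition acc_right (K : set R) (a : R) : Prop :=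
  forall e : R, 0 < e ->
    ~ finite_set [set I | interval_of K I /\ I `<=` `]a, a + e[] /\
    ~ finite_set [set G | gap K G /\ G `<=` `]a, a + e[].

Definition adj_right (K G : set R) : Prop :=
  exists I, interval_of K I /\ I (sup G) /\ (forall y, I y -> sup G <= y).
Definition adj_left (K G : set R) : Prop :=
  exists I, interval_of K I /\ I (inf G) /\ (forall y, I y -> y <= inf G).

Definition M_cantorval (K : set R) : Prop :=
  perfect_set K /\ forall G, gap K G -> acc_left K (inf G) /\ acc_right K (sup G).
Definition L_cantorval (K : set R) : Prop :=
  perfect_set K /\ forall G, gap K G -> adj_right K G /\ acc_left K (inf G).
Definition R_cantorval (K : set R) : Prop :=
  perfect_set K /\ forall G, gap K G -> adj_left K G /\ acc_right K (sup G).
Definition cantorval (K : set R) : Prop :=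
  [\/ M_cantorval K, L_cantorval K | R_cantorval K].

Definition finite_union_intervals (A : set R) : Prop :=
  exists (n : nat) (a b : nat -> R), (0 < n)%N /\ (forall i, (i < n)%N -> a i < b i) /\
    A = \bigcup_(i in `I_n) [set` `[a i, b i]].

End Defs.

(* Main.v *)
(* Write E for E_m(x), and T_k for the sums of the terms of index at least k, so
   that E = F_k + T_k with F_k finite and diam T_k -> 0. E is compact, perfect and
   symmetric. If E contains no interval, it is a Cantor set. Otherwise every T_k
   contains an interval.

   If ]a, b[ is a gap and diam T_k < b - a, then b is in F_k, and near b on the
   right E coincides with b + T_k, which itself looks like E near 0. Hence the
   behaviour of E at 0 decides everything:
   - if E contains some [0, d[, the terms smaller than d have sums filling an
     interval [0, L], and E is a finite union of translates of [0, L];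
   - if not, gaps and intervals of E accumulate at 0+, hence on the right of every
     gap and, by symmetry, on the left: E is an M-Cantorval. *)

Require Import Defs.
From HB Require Import structures.
From mathcomp Require Import all_boot all_order all_algebra.
From mathcomp Require Import all_classical all_reals all_analysis.
From mathcomp Require Import lra.
Import Order.TTheory GRing.Theory Num.Theory.
Import numFieldNormedType.Exports.
Local Open Scope classical_set_scope.
Local Open Scope ring_scope.

Set Implicit Arguments. Unset Strict Implicit. Unset Printing Implicit Defensive.

(** * Sums of a positive convergent series with bounded integer coefficients *)

Section Subsums.
Context {R : realType} (x : R ^nat) (m : nat).
Hypothesis xpos : forall n, 0 < x n.
Hypothesis xsum : cvgn (series x).
Implicit Types (e c : nat -> nat) (k : nat) (y z t : R).

Definition bounded_by c := forall i, (c i <= m)%N.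

Definition subsum e : R := limn (series (fun i => (e i)%:R * x i)).

(** A separate bound for each index lets heads, tails, small terms and large terms be treated alike;
    the constant bound [m] gives back [Em m x]. *)
Definition subsums c : set R :=
  [set y | exists e, (forall i, (e i <= c i)%N) /\ y = subsum e].

Definition headn k c : nat -> nat := fun i => if (i < k)%N then c i else 0%N.
Definition tailn k c : nat -> nat := fun i => if (i < k)%N then 0%N else c i.

Lemma bounded_le e c : bounded_by c -> (forall i, (e i <= c i)%N) -> bounded_by e.
Proof. by move=> cm ec i; exact: leq_trans (ec i) (cm i). Qed.

Lemma headn_le k c i : (headn k c i <= c i)%N.
Proof. by rewrite /headn; case: ifP. Qed.

Lemma tailn_le k c i : (tailn k c i <= c i)%N.
Proof. by rewrite /tailn; case: ifP. Qed.

Lemma head_tailn k c : c = (fun i => headn k c i + tailn k c i)%N.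
Proof. by apply/funext => i; rewrite /headn /tailn; case: ifP; rewrite ?addn0. Qed.

Lemma tailnS k c :
  tailn k c = (fun i => (if i == k then c k else 0) + tailn k.+1 c i)%N.
Proof.
apply/funext => i; rewrite /tailn ltnS.
by case: ltngtP => [//|//|->]; rewrite addn0.
Qed.

Lemma subsum_cvg e : bounded_by e -> cvgn (series (fun i => (e i)%:R * x i)).
Proof.
move=> em; apply: (@series_le_cvg _ _ (m%:R *: x)).
- by move=> n; rewrite mulr_ge0// ltW.
- by move=> n /=; rewrite mulr_ge0// ltW.
- by move=> n /=; rewrite ler_wpM2r ?ler_nat// ltW.
- exact: is_cvg_seriesZ.
Qed.

Lemma subsumD e1 e2 : bounded_by e1 -> bounded_by e2 ->
  subsum (fun i => e1 i + e2 i)%N = subsum e1 + subsum e2.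
Proof.
move=> /subsum_cvg c1 /subsum_cvg c2; rewrite /subsum -lim_seriesD//.
by congr (limn (series _)); apply/funext => i; rewrite natrD mulrDl.
Qed.

Lemma subsum_le e1 e2 : bounded_by e2 -> (forall i, (e1 i <= e2 i)%N) ->
  subsum e1 <= subsum e2.
Proof.
move=> b2 e12; apply: lim_series_le; [|exact: subsum_cvg|].
  by apply: subsum_cvg; exact: (bounded_le b2).
by move=> n; rewrite ler_wpM2r ?ler_nat// ltW.
Qed.

Lemma subsum_finite k e : (forall i, (k <= i)%N -> e i = 0%N) ->
  subsum e = \sum_(i < k) (e i)%:R * x i.
Proof.
move=> e0; apply/cvg_lim => //; apply/cvgrPdist_lt => d d0.
exists k => // n /= kn; rewrite -(big_mkord xpredT (fun i => (e i)%:R * x i)).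
rewrite /series/= [X in _ - X](big_cat_nat (n := k))//= opprD addrA subrr sub0r normrN.
rewrite big_nat_cond big1 ?normr0// => i; rewrite andbT => /andP[ki _].
by rewrite e0// mul0r.
Qed.

Lemma subsum0 : subsum (fun=> 0%N) = 0.
Proof. by rewrite (@subsum_finite 0)// big_ord0. Qed.

Lemma subsum_ge0 e : bounded_by e -> 0 <= subsum e.
Proof. by move=> em; rewrite -subsum0 subsum_le. Qed.

Lemma subsum_delta k n : subsum (fun i => if i == k then n else 0%N) = n%:R * x k.
Proof.
rewrite (@subsum_finite k.+1); last by move=> i; case: eqVneq => // ->; rewrite ltnn.
by rewrite big_ord_recr/= eqxx big1 ?add0r// => i _; rewrite ltn_eqF// mul0r.
Qed.

Lemma subsum_delta1 k : subsum (fun i => if i == k then 1%N else 0%N) = x k.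
Proof. by rewrite subsum_delta mul1r. Qed.

Lemma subsum_ge_term e k : bounded_by e -> (e k)%:R * x k <= subsum e.
Proof.
by move=> em; rewrite -subsum_delta subsum_le// => i; case: eqVneq => // ->.
Qed.

Lemma subsum_headE k e : subsum (headn k e) = series (fun i => (e i)%:R * x i) k.
Proof.
rewrite (@subsum_finite k); last by move=> i ki; rewrite /headn ltnNge ki.
by rewrite seriesEord/=; apply: eq_bigr => i _; rewrite /headn ltn_ord.
Qed.

Lemma subsum_splitn k c : bounded_by c ->
  subsum c = subsum (headn k c) + subsum (tailn k c).
Proof.
move=> cm; rewrite -subsumD.
- by congr subsum; exact: head_tailn.
- by apply: (bounded_le cm); exact: headn_le.
- by apply: (bounded_le cm); exact: tailn_le.
Qed.

Lemma subsum_tail_cvg0 c : bounded_by c -> subsum (tailn k c) @[k --> \oo] --> (0 : R).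
Proof.
move=> cm; rewrite (_ : (fun k => _) = fun k =>
   subsum c - series (fun i => (c i)%:R * x i) k).
  by rewrite -(subrr (subsum c)); apply: cvgB; [exact: cvg_cst|exact: subsum_cvg].
by apply/funext => k; rewrite -subsum_headE (subsum_splitn k cm) [RHS]addrC addKr.
Qed.

Lemma subsum_tail_lt c t : bounded_by c -> 0 < t ->
  exists k, forall n, (k <= n)%N -> subsum (tailn n c) < t.
Proof.
move=> cm t0; have /cvgrPdist_lt/(_ _ t0)[k _ kt] := subsum_tail_cvg0 cm.
exists k => n kn; have /= := kt n kn; rewrite sub0r normrN.
exact/le_lt_trans/ler_norm.
Qed.

Lemma subsumsW c1 c2 : (forall i, (c1 i <= c2 i)%N) -> subsums c1 `<=` subsums c2.
Proof. by move=> c12 y [e [ec ->]]; exists e; split=> // i; exact: leq_trans (c12 i). Qed.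

Lemma subsums0 c : subsums c 0.
Proof. by exists (fun=> 0%N); rewrite subsum0. Qed.

Lemma subsums_max c : subsums c (subsum c).
Proof. by exists c. Qed.

Lemma subsums_ge0 c y : bounded_by c -> subsums c y -> 0 <= y.
Proof. by move=> cm [e [ec ->]]; apply: subsum_ge0; exact: (bounded_le cm). Qed.

Lemma subsums_le c y : bounded_by c -> subsums c y -> y <= subsum c.
Proof. by move=> cm [e [ec ->]]; exact: subsum_le. Qed.

(** Replacing each coefficient [e i] by [c i - e i] reflects the set about half its maximum. *)
Lemma subsums_sym c y : bounded_by c -> subsums c y -> subsums c (subsum c - y).
Proof.
move=> cm [e [ec ->]]; exists (fun i => c i - e i)%N; split=> [i|]; first exact: leq_subr.
have ce : (fun i => (c i - e i) + e i)%N = c by apply/funext => i; rewrite subnK.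
rewrite -[X in subsum X - _]ce subsumD ?addrK//; last exact: (bounded_le cm).
by apply: (bounded_le cm) => i; exact: leq_subr.
Qed.

Lemma subsumsD c1 c2 y : bounded_by (fun i => c1 i + c2 i)%N ->
  subsums (fun i => c1 i + c2 i)%N y <->
  exists y1 y2, [/\ subsums c1 y1, subsums c2 y2 & y = y1 + y2].
Proof.
move=> cm; have c1m : bounded_by c1 by apply: (bounded_le cm) => i /=; exact: leq_addr.
have c2m : bounded_by c2 by apply: (bounded_le cm) => i /=; exact: leq_addl.
split=> [[e [ec ->]]|[_ [_ [[e1 [ec1 ->]] [e2 [ec2 ->]] ->]]]]; last first.
  exists (fun i => e1 i + e2 i)%N; split=> [i|]; first exact: leq_add.
  by rewrite subsumD//; [exact: (bounded_le c1m)|exact: (bounded_le c2m)].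
(* Greedy splitting: [e1] takes as much of [e] as [c1] allows, and the rest fits under [c2] because
   [e i <= c1 i + c2 i]. *)
pose e1 i := minn (e i) (c1 i); pose e2 i := (e i - e1 i)%N.
have ec1 i : (e1 i <= c1 i)%N by exact: geq_minr.
have ec2 i : (e2 i <= c2 i)%N.
  by rewrite leq_subLR /e1 /minn; case: ifP => _; [exact: leq_addr|exact: ec].
exists (subsum e1), (subsum e2); split; [by exists e1|by exists e2|].
rewrite -subsumD; [|exact: (bounded_le c1m)|exact: (bounded_le c2m)].
by congr subsum; apply/funext => i; rewrite /e2 subnKC// geq_minl.
Qed.

Lemma subsums_splitn k c y : bounded_by c -> subsums c y <->
  exists y1 y2, [/\ subsums (headn k c) y1, subsums (tailn k c) y2 & y = y1 + y2].
Proof.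
move=> cm; have := @subsumsD (headn k c) (tailn k c) y.
by rewrite -head_tailn; exact.
Qed.

(** Passes from one tail to the next: each is a union of finitely many translates of its successor,
    one for every coefficient of [x k]. *)
Lemma subsums_tailS k c y : bounded_by c -> subsums (tailn k c) y <->
  exists j, (j <= c k)%N /\ subsums (tailn k.+1 c) (y - j%:R * x k).
Proof.
move=> cm; rewrite tailnS subsumsD; last first.
  by rewrite -tailnS; apply: (bounded_le cm); exact: tailn_le.
split=> [[_ [y2 [[e [ec ->]] Hy2 ->]]]|[j [jc Hj]]].
  exists (e k); split; first by have := ec k; rewrite eqxx.
  suff -> : e = (fun i => if i == k then e k else 0%N) by rewrite subsum_delta eqxx addrC addKr.
  apply/funext => i; case: eqVneq => [->//|/negbTE ik].
  by have := ec i; rewrite ik leqn0 => /eqP.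
exists (j%:R * x k), (y - j%:R * x k); split=> //; last by rewrite addrC subrK.
exists (fun i => if i == k then j else 0%N); rewrite subsum_delta; split=> // i.
by case: eqVneq.
Qed.

Lemma subsums_finite k c : (forall i, (k <= i)%N -> c i = 0%N) -> bounded_by c ->
  finite_set (subsums c).
Proof.
move=> c0 cm.
apply: (@sub_finite_set _ _ ((fun f : {ffun 'I_k -> 'I_m.+1} =>
   \sum_(i < k) (f i)%:R * x i) @` setT)); last exact/finite_image/finite_finset.
move=> _ [e [ec ->]]; exists [ffun i : 'I_k => inord (e i)] => //.
rewrite (@subsum_finite k); last first.
  by move=> i /c0 ci; have := ec i; rewrite ci leqn0 => /eqP.
apply: eq_bigr => i _; rewrite ffunE inordK// ltnS.
exact: leq_trans (ec i) (cm i).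
Qed.

Lemma subsums_headn_finite k c : bounded_by c -> finite_set (subsums (headn k c)).
Proof.
move=> cm; apply: (@subsums_finite k) => [i|]; first by rewrite /headn ltnNge => ->.
by apply: (bounded_le cm); exact: headn_le.
Qed.

(** The set is the image under [subsum] of a product of finite discrete sets, which is compact by
    Tychonoff; [subsum] is continuous there because late coefficients contribute little. *)
Lemma subsums_compact c : bounded_by c -> compact (subsums c).
Proof.
move=> cm.
have -> : subsums c = subsum @` [set e : prod_topology (fun _ : nat => nat) |
    forall i, [set n | (n <= c i)%N] (e i)].
  by apply/seteqP; split=> [y [e [ec ->]]|_ [e ec <-]]; exists e.
apply: continuous_compact; last first.
  apply: (@tychonoff nat (fun=> nat) (fun i => [set n | (n <= c i)%N])) => i.
  apply: finite_compact.
  by apply: (@sub_finite_set _ _ `I_(c i).+1) => // n; rewrite /= ltnS.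
apply/subspace_continuousP => e ec; apply/cvgrPdist_lt => d d0.
have [k /(_ _ (leqnn k)) kd] := subsum_tail_lt cm d0.
(* In the product topology, agreeing with [e] at the first k places is a neighbourhood condition,
   since each coordinate is discrete. *)
have : \forall f \near (e : prod_topology (fun _ : nat => nat)),
    forall i, (i < k)%N -> e i = f i.
  elim: k {kd} => [|k IH]; first by near=> f => i; rewrite ltn0.
  near=> f => i; rewrite ltnS leq_eqVlt => /predU1P[->|]; last by move: i; near: f.
  near: f; have := @proj_continuous nat (fun=> nat) k e [set e k] (discrete_set1 _).
  by apply: filterS => f /= ->.
apply: filterS => f ef fc.
(* With equal heads, the sums of [e] and [f] differ by two tails that both lie in [[0, d[]. *)
have tl g : (forall i, (g i <= c i)%N) -> 0 <= subsum (tailn k g) < d.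
  move=> gc; apply/andP; split.
    by apply: subsum_ge0; apply: (bounded_le cm) => i; exact: leq_trans (tailn_le _ _ _) (gc i).
  apply: le_lt_trans kd; apply: subsum_le.
    by apply: (bounded_le cm); exact: tailn_le.
  by move=> i; rewrite /tailn; case: ifP.
rewrite /from_subspace/= (subsum_splitn k (bounded_le cm ec)) (subsum_splitn k (bounded_le cm fc)).
have -> : headn k f = headn k e.
  by apply/funext => i; rewrite /headn; case: ifP => // /ef ->.
have /andP[] := tl e ec; have /andP[] := tl f fc => *.
by rewrite opprD addrACA subrr add0r ltr_norml; lra.
Unshelve. all: by end_near. Qed.

Lemma subsums_closed c : bounded_by c -> closed (subsums c).
Proof. by move=> cm; apply: compact_closed; [exact: Rhausdorff|exact: subsums_compact]. Qed.

Lemma summable_term_lt t : 0 < t -> exists k, forall n, (k <= n)%N -> x n < t.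
Proof.
move=> t0; have /cvgrPdist_lt/(_ _ t0)[k _ kt] := cvg_series_cvg_0 xsum.
exists k => n kn; have /= := kt n kn; rewrite sub0r normrN.
exact/le_lt_trans/ler_norm.
Qed.

End Subsums.

(** * Gaps, intervals and accumulation for subsets of the line *)

Section RealSets.
Context {R : realType}.
Implicit Types (K G : set R) (a b p q t u v z : R).

Definition has_interval K := exists p q, p < q /\ [set` `[p, q]] `<=` K.

(** A working substitute for [acc_right]: a single missing point and a single interval at every
    scale, instead of infinitely many components. *)
Definition near_right K b := forall e, 0 < e ->
  (exists t, b < t < b + e /\ ~ K t) /\
  (exists p q, [/\ b < p, p < q, q < b + e & [set` `[p, q]] `<=` K]).

Definition near_left K a := forall e, 0 < e ->
  (exists t, a - e < t < a /\ ~ K t) /\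
  (exists p q, [/\ a - e < p, p < q, q < a & [set` `[p, q]] `<=` K]).

Lemma component_between K t u v : ~ K u -> ~ K v -> u < t < v ->
  connected_component K t `<=` `]u, v[.
Proof.
move=> Ku Kv utv z tz; have Kt : K t.
  by apply: connected_component_sub; apply: connected_component_sym tz.
have /connected_intervalP ivl := @component_connected _ K t.
have tt := connected_component_refl Kt; rewrite /= in_itv/=.
apply/andP; split; rewrite ltNge; apply/negP => le.
  by apply: Ku; apply: (@connected_component_sub _ K t); apply: (ivl _ _ tz tt); lra.
by apply: Kv; apply: (@connected_component_sub _ K t); apply: (ivl _ _ tt tz); lra.
Qed.

Lemma gap_between K t u v : K u -> K v -> ~ K t -> u < t < v ->
  exists G, [/\ gap K G, G t & G `<=` `]u, v[].
Proof.
move=> Ku Kv Kt utv; exists (connected_component (~` K) t).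
have sub : connected_component (~` K) t `<=` `]u, v[ by apply: component_between => //; exact.
split=> //; last exact: connected_component_refl.
split; first by exists t.
exists (`|u| + `|v|); split; first exact: num_real.
move=> M M_gt z /sub/=; rewrite in_itv/= => /andP[uz zv].
have := ler_norm (- u); rewrite normrN ler_norml.
by move: (ler_norm v) (normr_ge0 u) (normr_ge0 v) => *; lra.
Qed.

Lemma interval_between K p q u v : ~ K u -> ~ K v -> u < p -> p < q -> p < v ->
  [set` `[p, q]] `<=` K ->
  exists I, [/\ interval_of K I, I p & I `<=` `]u, v[].
Proof.
move=> Ku Kv up pq pv pqK.
have pin : [set` `[p, q]] p by rewrite /= in_itv/= lexx ltW.
have qin : [set` `[p, q]] q by rewrite /= in_itv/= lexx ltW.
have Kp := pqK _ pin.
exists (connected_component K p); split; [|exact: connected_component_refl|].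
  split; first by exists p.
  exists p, q; split; [exact: connected_component_refl|split; last by rewrite lt_eqF].
  apply: (connected_component_max pin pqK) => //.
  by apply/connected_intervalP; exact: interval_is_interval.
by apply: component_between => //; rewrite up.
Qed.

(** The minimum of finitely many admissible radii is positive and stays admissible, since [P d]
    survives shrinking. *)
Lemma finite_pos_lbound (T : choiceType) (D : set T) (P : T -> R -> Prop) :
  finite_set D ->
  (forall d (r s : R), s <= r -> P d r -> P d s) ->
  (forall d, D d -> exists2 r, 0 < r & P d r) ->
  exists2 r, 0 < r & forall d, D d -> P d r.
Proof.
move=> /finite_seqP[s ->{D}] Pmono; elim: s => [|d s IH] Ps; first by exists 1.
have [|r r0 Pr] := IH; first by move=> d' ds; apply: Ps; rewrite /= inE ds orbT.
have [|r' r'0 Pr'] := Ps d; first by rewrite /= inE eqxx.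
exists (Num.min r r'); first by rewrite lt_min r0.
move=> d'; rewrite /= inE => /predU1P[->|/Pr].
  by apply: Pmono Pr'; rewrite ge_min lexx orbT.
by apply: Pmono; rewrite ge_min lexx.
Qed.

(** If only finitely many members of [Q] lay in [B r], a smaller [B s] would contain none of the
    nonempty ones, yet [B (min r s)] still contains some. *)
Lemma infinite_shrinking (Q : set (set R)) (B : R -> set R) :
  (forall r s, r <= s -> B r `<=` B s) ->
  (forall z, exists2 r, 0 < r & ~ B r z) ->
  (forall r, 0 < r -> exists I, [/\ Q I, I !=set0 & I `<=` B r]) ->
  forall r, 0 < r -> ~ finite_set [set I | Q I /\ I `<=` B r].
Proof.
move=> Bmono Bout QB r r0 fin.
have [||s s0 Ds] := @finite_pos_lbound _ _
  (fun I s => I !=set0 -> ~ (I `<=` B s)) fin.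
- move=> I s' s ss' h /h H IB; apply: H; exact: subset_trans (Bmono _ _ ss').
- move=> I _; have [[z Iz]|] := pselect (I !=set0); last by exists 1.
  by have [s s0 Bz] := Bout z; exists s => // _ /(_ _ Iz).
have rs0 : 0 < Num.min r s by rewrite lt_min r0.
have [I [QI I0 IB]] := QB _ rs0; apply: (Ds I) => //.
  by split=> //; apply: subset_trans IB _; apply: Bmono; rewrite ge_min lexx.
by apply: subset_trans IB _; apply: Bmono; rewrite ge_min lexx orbT.
Qed.

Lemma near_right_acc K b : near_right K b -> acc_right K b.
Proof.
move=> nb e e0.
pose B (r : R) : set R := [set` `]b, b + r[].
have Bm r s : r <= s -> B r `<=` B s by move=> rs z; rewrite /B /= !in_itv/=; lra.
have Bo z : exists2 r, 0 < r & ~ B r z.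
  have [zb|bz] := leP z b; first by exists 1 => //; rewrite /B /= in_itv/=; lra.
  by exists (z - b); [lra|rewrite /B /= in_itv/=; lra].
split; apply: (infinite_shrinking Bm Bo) => // r r0.
(* Moving towards [b]: a missing point [t], an interval [[p, q]], a missing point [t']. The
   component of [p] is trapped in []t', t[]. *)
- have [[t [/andP[bt tb] Kt]] _] := nb r r0.
  have [_ [p [q [bp pq qt pqK]]]] := nb (t - b) ltac:(lra).
  have [[t' [/andP[bt' t'p] Kt']] _] := nb (p - b) ltac:(lra).
  have [||I [HI Ip IB]] := @interval_between K p q t' t Kt' Kt _ pq _ pqK; try lra.
  exists I; split=> //; first by exists p.
  by move=> z /IB; rewrite /B /= !in_itv/=; lra.
(* Dually, the missing point [t] sits between two intervals, so its gap is trapped in []p', p[]. *)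
- have [_ [p [q [bp pq qt pqK]]]] := nb r r0.
  have [[t [/andP[bt tb] Kt]] _] := nb (p - b) ltac:(lra).
  have [_ [p' [q' [bp' pq' qt' pqK']]]] := nb (t - b) ltac:(lra).
  have [|||G [HG Gt GB]] := @gap_between K t p' p _ _ Kt.
  + by apply: pqK'; rewrite /= in_itv/=; lra.
  + by apply: pqK; rewrite /= in_itv/=; lra.
  + by lra.
  exists G; split=> //; first by exists t.
  by move=> z /GB; rewrite /B /= !in_itv/=; lra.
Qed.

Lemma near_left_acc K a : near_left K a -> acc_left K a.
Proof.
move=> na e e0.
pose B (r : R) : set R := [set` `]a - r, a[].
have Bm r s : r <= s -> B r `<=` B s by move=> rs z; rewrite /B /= !in_itv/=; lra.
have Bo z : exists2 r, 0 < r & ~ B r z.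
  have [az|za] := leP a z; first by exists 1 => //; rewrite /B /= in_itv/=; lra.
  by exists (a - z); [lra|rewrite /B /= in_itv/=; lra].
split; apply: (infinite_shrinking Bm Bo) => // r r0.
- have [[t [/andP[bt tb] Kt]] _] := na r r0.
  have [_ [p [q [bp pq qt pqK]]]] := na (a - t) ltac:(lra).
  have [[t' [/andP[bt' t'p] Kt']] _] := na (a - q) ltac:(lra).
  have [||I [HI Ip IB]] := @interval_between K p q t t' Kt Kt' _ pq _ pqK; try lra.
  exists I; split=> //; first by exists p.
  by move=> z /IB; rewrite /B /= !in_itv/=; lra.
- have [_ [p [q [bp pq qt pqK]]]] := na r r0.
  have [[t [/andP[bt tb] Kt]] _] := na (a - q) ltac:(lra).
  have [_ [p' [q' [bp' pq' qt' pqK']]]] := na (a - t) ltac:(lra).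
  have [|||G [HG Gt GB]] := @gap_between K t q p' _ _ Kt.
  + by apply: pqK; rewrite /= in_itv/=; lra.
  + by apply: pqK'; rewrite /= in_itv/=; lra.
  + by lra.
  exists G; split=> //; first by exists t.
  by move=> z /GB; rewrite /B /= !in_itv/=; lra.
Qed.

Lemma closed_ball_out K z : closed K -> ~ K z ->
  exists2 e, 0 < e & [set` `]z - e, z + e[] `<=` ~` K.
Proof.
move=> /closed_openC oK Kz; have /nbhs_ballP[e /= e0 eK] := open_nbhs_nbhs (conj oK Kz).
exists e => // y; rewrite /= in_itv/= => zy; apply: eK.
by rewrite /ball/= ltr_norml; lra.
Qed.

Lemma closed_next (K : set R) t v : closed K -> K v -> t <= v ->
  exists b, [/\ K b, t <= b & forall z, K z -> t <= z -> b <= z].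
Proof.
move=> clK Kv tv; pose B := K `&` [set z | t <= z].
have hB : has_inf B by split; [exists v|exists t => z []].
have lb z : B z -> inf B <= z by move=> Bz; exact: ge_inf hB.2 _ Bz.
have tb : t <= inf B by apply: lb_le_inf hB.1 _ => z [].
exists (inf B); split=> //; last by move=> z Kz tz; exact: lb.
apply: contrapT => /(closed_ball_out clK)[e e0 eK].
have [z Bz zb] := inf_adherent e0 hB; have := lb _ Bz => bz.
by apply: (eK z) Bz.1; rewrite /= in_itv/=; lra.
Qed.

Lemma gap_endpoints K G : closed K -> gap K G ->
  [/\ inf G < sup G, K (inf G), K (sup G) &
      forall z, inf G < z < sup G -> ~ K z].
Proof.
move=> clK [[t [Kt ->{G}]] [M [_ bG]]].
set G := connected_component _ _ in bG *.
have Gt : G t by exact: connected_component_refl.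
have GK z : G z -> ~ K z by move=> /connected_component_sub.
have hG : has_sup G.
  split; first by exists t.
  exists (M + 1) => z /(bG (M + 1) ltac:(lra)) /= Mz.
  exact: le_trans (ler_norm _) Mz.
have hI : has_inf G.
  split; first by exists t.
  exists (- (M + 1)) => z /(bG (M + 1) ltac:(lra)) /=.
  by rewrite ler_norml => /andP[].
(* A ball missing [K] and meeting the component [G] lies in [G]; so if [sup G] or [inf G] were
   outside [K], [G] would extend beyond it. *)
have Gext z e g : [set` `]z - e, z + e[] `<=` ~` K -> G g -> z - e < g < z + e ->
    [set` `]z - e, z + e[] `<=` G.
  move=> zK Gg ge; rewrite /G (same_connected_component Gg).
  apply: connected_component_max; [by rewrite /= in_itv|exact: zK|].
  by apply/connected_intervalP; exact: interval_is_interval.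
have supK : K (sup G).
  apply: contrapT => /(closed_ball_out clK)[e e0 eK].
  have [g Gg lg] := sup_adherent e0 hG.
  have gs : g <= sup G by exact: ub_le_sup hG.2 _ Gg.
  have := Gext _ _ g eK Gg ltac:(lra) (sup G + e / 2).
  rewrite /= in_itv/= => /(_ ltac:(lra)) /(ub_le_sup hG.2); lra.
have infK : K (inf G).
  apply: contrapT => /(closed_ball_out clK)[e e0 eK].
  have [g Gg lg] := inf_adherent e0 hI.
  have gs : inf G <= g by exact: ge_inf hI.2 _ Gg.
  have := Gext _ _ g eK Gg ltac:(lra) (inf G - e / 2).
  rewrite /= in_itv/= => /(_ ltac:(lra)) /(ge_inf hI.2); lra.
have ti : inf G <= t by exact: ge_inf hI.2 _ Gt.
have ts : t <= sup G by exact: ub_le_sup hG.2 _ Gt.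
split=> //.
  rewrite lt_neqAle (le_trans ti ts) andbT; apply/eqP => E.
  by apply: Kt; rewrite (_ : t = sup G)//; apply/le_anti; rewrite ts -E ti.
move=> z /andP[iz zs]; apply: GK.
have /connected_intervalP ivl := @component_connected _ (~` K) t.
have [g1 Gg1 g1z] := inf_lt hI.1 iz; have [g2 Gg2 g2z] := sup_gt hG.1 zs.
by apply: (ivl _ _ Gg1 Gg2); lra.
Qed.

(** A finite Baire argument by induction on [n]: either the last set contains the whole interval, or
    it misses a neighbourhood of one of its points, and the remaining sets cover what the interval
    has there. *)
Lemma closed_bigcup_interval (F : nat -> set R) n p q : (forall j, closed (F j)) ->
  p < q -> (forall z, p <= z <= q -> exists2 j, (j < n)%N & F j z) ->
  exists2 j, (j < n)%N & has_interval (F j).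
Proof.
move=> clF; elim: n p q => [|n IH] p q pq cover.
  by have [|j] := cover p; rewrite ?lexx ?ltW.
have [sub|/existsNP[z /not_implyP[/=]]] := pselect ([set` `[p, q]] `<=` F n).
  by exists n => //; exists p, q.
rewrite in_itv/= => zpq /(closed_ball_out (clF n))[e e0 eF].
(* Halving the radius keeps the closed subinterval inside the open ball that avoids [F n]. *)
have [||j jn Fj] := IH (Num.max p (z - e / 2)) (Num.min q (z + e / 2)).
- by rewrite lt_min !gt_max; lra.
- move=> y; rewrite ge_max le_min => zy; have [|j] := cover y; first by lra.
  rewrite ltnS leq_eqVlt => /predU1P[->|jn] Fy; last by exists j.
  by have /eF : [set` `]z - e, z + e[] y by rewrite /= in_itv/=; lra.
- by exists j => //; exact: ltnW.
Qed.

End RealSets.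

(** * Topological characterization of Cantor sets on the line *)

Section CantorSets.
Context {R : realType}.
Implicit Types A B : set R.

(** Total disconnectedness is the main point: between two points of [A] there is some [t] outside
    [A], and cutting at [t] gives a clopen set separating them. *)
Lemma set_type_cantor_like A : compact A -> perfect_set A -> ~ has_interval A ->
  cantor_like (set_type A).
Proof.
move=> cptA [_ limA] noint.
have openV (V : set R) : open V -> open ((\val : set_type A -> R) @^-1` V).
  by move=> oV; exists V.
have valA (w : set_type A) : A (\val w) by exact: set_valP.
have zdim : zero_dimensional (set_type A).
  move=> u v uv.
  have clopen_lt (t : R) : ~ A t -> clopen [set w : set_type A | \val w < t].
    move=> At; split; first exact: (openV [set z | z < t] (@open_lt R t)).
    rewrite -openC (_ : ~` _ = [set w : set_type A | t < \val w]).
      exact: (openV [set z | t < z] (@open_gt R t)).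
    apply/seteqP; split=> w /=; last by move=> tw /(lt_trans tw); rewrite ltxx.
    move=> /negP; rewrite -leNgt le_eqVlt => /predU1P[tw|//]; exfalso.
    by apply: At; rewrite tw; exact: valA.
  have between (a b : R) : a < b -> exists2 t, a < t < b & ~ A t.
    move=> ab; apply: contrapT => /forall2NP H; apply: noint.
    (* The middle half of []a, b[] is a nondegenerate closed interval avoiding the endpoints. *)
    exists ((3 * a + b) / 4), ((a + 3 * b) / 4); split; first by lra.
    move=> z /=; rewrite in_itv/= => zab; have [|/contrapT//] := H z.
    by move/negP; lra.
  have uv' : \val u != \val v by rewrite (inj_eq val_inj).
  have [|vu|/eqP] := ltgtP (\val u) (\val v); last by rewrite (negbTE uv').
    move=> /between[t /andP[ut tv] At]; exists [set w | \val w < t]; split=> //=.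
      exact: clopen_lt.
    by apply/negP; rewrite -leNgt ltW.
  have [t /andP[vt tu] At] := between _ _ vu.
  exists (~` [set w | \val w < t]); split; first by apply: (clopenC set0); exact: clopen_lt.
    by apply/negP; rewrite -leNgt ltW.
  by rewrite /= => /(_ vt).
split=> //.
- apply/perfectTP => u [V oV Vu].
  have : limit_point A (\val u) by rewrite limA; exact: valA.
  move=> /(_ V); case.
    apply: open_nbhs_nbhs; split=> //.
    by have : [set u] u by []; rewrite -Vu.
  move=> y [yu Ay Vy]; have : (\val @^-1` V) (exist _ y (mem_set Ay) : set_type A) by [].
  by rewrite Vu => /= yE; move: yu; rewrite -yE eqxx.
- move=> F PF _; have [|a [Aa clFa]] := cptA ((\val : set_type A -> R) @ F) _.
    by rewrite nbhs_simpl/=; apply: filterS filterT => w _; exact: valA.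
  exists (exist _ a (mem_set Aa) : set_type A); split=> // U W FU [_ [[V oV <-] Va VW]].
  have [||y [/= [w Uw <-] Vw]] := clFa (\val @` U) V.
  + by rewrite nbhs_simpl/=; apply: filterS FU => w Uw; exists w.
  + by apply: open_nbhs_nbhs.
  by exists w; split=> //; exact: VW.
- rewrite open_hausdorff => u v /zdim[U [[oU cU] Uu Uv]].
  exists (U, ~` U) => /=; first by rewrite !inE.
  by split=> //; [rewrite openC|rewrite setICr].
Qed.

(** Brouwer's theorem, [homeomorphism_cantor_like], applied to [A] as a subspace based at [a], then
    composed with the inclusion into the line. *)
Lemma cantor_space_param A : A !=set0 -> compact A -> perfect_set A ->
  ~ has_interval A ->
  exists f : cantor_space -> R, [/\ continuous f, injective f & range f = A].
Proof.
move=> [a Aa] cptA perfA noint; have cl := set_type_cantor_like cptA perfA noint.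
pose T : pseudoPMetricType R :=
  HB.pack (set_type A) (isPointed.Build (set_type A) (exist _ a (mem_set Aa))).
have [f [cf _]] := @homeomorphism_cantor_like R T cl.
exists (fun c => \val (f c : set_type A)); split.
- move=> c; apply: (@continuous_comp _ (set_type A) R f \val); first exact: cf.
  exact: (@initial_continuous (set_type A) R \val).
- by move=> c d /val_inj; apply: (@inj _ _ setT f); rewrite inE.
- apply/seteqP; split=> [_ [c _ <-]|y Ay]; first exact: set_valP.
  have [c _ fc] := @surj _ _ setT setT f (exist _ y (mem_set Ay)) I.
  by exists c => //; rewrite fc.
Qed.

(** A continuous map from a compact space to a Hausdorff space is closed, so the image of the
    complement of an open set can be removed from a neighbourhood. *)
Lemma compact_inverse_continuous (X Y : topologicalType) (f : X -> Y) (g : Y -> X) :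
  compact [set: X] -> hausdorff_space Y -> continuous f ->
  (forall c, g (f c) = c) -> {within range f, continuous g}.
Proof.
move=> cptX hY cf gf; apply/subspace_continuousP => _ [c _ <-] U.
rewrite /from_subspace/= gf nbhsE => -[V [oV Vc] VU].
have clf : closed (f @` (~` V)).
  apply: compact_closed => //; apply: continuous_compact; first exact: continuous_subspaceT.
  by apply: (@subclosed_compact _ _ [set: X]) => //; exact: open_closedC.
rewrite nbhs_simpl/=; have : nbhs (f c) (~` (f @` (~` V))).
  apply: open_nbhs_nbhs; split; first by rewrite openC.
  by move=> [d Vd fd]; apply: Vd; rewrite -(gf d) fd gf.
apply: filterS => y fVy [d _ dy]; apply: VU.
by apply: contrapT => Vg; apply: fVy; exists d => //; move: Vg; rewrite -dy /= gf.
Qed.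

(** Both sets are parametrized by the Cantor space; the homeomorphism undoes one parametrization and
    applies the other. *)
Lemma homeomorphic_cantor A B : A !=set0 -> compact A -> perfect_set A ->
  ~ has_interval A -> B !=set0 -> compact B -> perfect_set B -> ~ has_interval B ->
  homeomorphic A B.
Proof.
move=> A0 cA pA nA B0 cB pB nB.
have [f [cf inf fA]] := cantor_space_param A0 cA pA nA.
have [g [cg ing gB]] := cantor_space_param B0 cB pB nB.
have inv (h : cantor_space -> R) : injective h ->
    exists h', forall c, h' (h c) = c.
  (* Outside the range of [h] the inverse takes the default value [point]. *)
  move=> injh; exists (fun y => xget point [set c | h c = y]) => c.
  by apply: injh; apply: (@xgetPex _ point [set d | h d = h c]); exists c.
have [f' ff'] := inv f inf; have [g' gg'] := inv g ing.
have ctsinv := compact_inverse_continuous cantor_space_compact (@Rhausdorff R).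
exists (g \o f'), (f \o g'); split.
- by move=> _ [y _ <-]; rewrite -gB; exists (f' y).
- by move=> _ [y _ <-]; rewrite -fA; exists (g' y).
- by rewrite -fA => _ [c _ <-] /=; rewrite ff' gg' .
- by rewrite -gB => _ [c _ <-] /=; rewrite gg' ff'.
split.
- rewrite -fA; apply: within_continuous_comp; last exact: ctsinv.
  by move=> c _; exact: cg.
- rewrite -gB; apply: within_continuous_comp; last exact: ctsinv.
  by move=> c _; exact: cf.
Qed.

End CantorSets.

(** * Structure of the set of sums near its points and gaps *)

Section Trichotomy.
Context {R : realType} (x : R ^nat) (m : nat).
Hypothesis xpos : forall n, 0 < x n.
Hypothesis xsum : cvgn (series x).
Implicit Types (c : nat -> nat) (k : nat) (a b p q t z : R).

Let cm : bounded_by m (fun=> m). Proof. by move=> i. Qed.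
Let tlm k c : bounded_by m c -> bounded_by m (tailn k c).
Proof. by move=> cm'; apply: (bounded_le cm'); exact: tailn_le. Qed.

(** Changing one far coefficient by 1, up if it is 0 and down otherwise, moves the sum by an
    arbitrarily small [x k]. *)
Lemma subsums_perfect : (0 < m)%N -> perfect_set (subsums x (fun=> m)).
Proof.
move=> m0; have cl := subsums_closed xpos xsum cm; split=> //.
apply/seteqP; split=> [y Ly|y [e [em ->]] U].
  by rewrite [X in X y](closure_id _).1// => U /Ly[z [_ Ez Uz]]; exists z.
move=> /nbhs_ballP[d /= d0 dU]; have [k /(_ k (leqnn k)) xk] := summable_term_lt xsum d0.
have em' : bounded_by m e := em.
have dm : bounded_by m (fun i => if i == k then 1%N else 0%N) by move=> i; case: ifP.
have xk0 := xpos k.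
have [ek0|ek0] := posnP (e k).
  exists (subsum x e + x k); split; first by rewrite gt_eqF// ltrDl.
    exists (fun i => e i + if i == k then 1 else 0)%N; split.
      by move=> i; case: eqVneq => [->|_]; rewrite ?ek0 ?addn0.
    by rewrite (subsumD xpos xsum em' dm) subsum_delta1.
  by apply: dU; rewrite /ball/= ltr_norml; lra.
have e'm : bounded_by m (fun i => e i - if i == k then 1 else 0)%N.
  by apply: (bounded_le em') => i; exact: leq_subr.
have eE : subsum x e = subsum x (fun i => e i - if i == k then 1 else 0)%N + x k.
  rewrite -subsum_delta1 -(subsumD xpos xsum e'm dm).
  congr subsum; apply/funext => i; rewrite subnK//.
  by case: eqVneq => [->|].
exists (subsum x (fun i => e i - if i == k then 1 else 0)%N); split.
- by rewrite eE lt_eqF// ltrDl.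
- by exists (fun i => e i - if i == k then 1 else 0)%N.
- by apply: dU; rewrite /ball/= eE ltr_norml; lra.
Qed.

(** When the k-th tail is shorter than [b - t], dropping it from a representation of [b] leaves a
    sum above [t], hence at least [b]; the dropped part was 0. *)
Lemma subsums_gap_right c b t : bounded_by m c -> subsums x c b -> t < b ->
  (forall z, subsums x c z -> t < z -> b <= z) ->
  exists k0, forall k, (k0 <= k)%N -> subsums x (headn k c) b.
Proof.
move=> bc Eb tb gapb; have bt0 : 0 < b - t by rewrite subr_gt0.
have [k0 Hk0] := subsum_tail_lt xpos xsum bc bt0; exists k0 => k /Hk0 kbt.
have [y1 [y2 [H1 H2 bE]]] := (subsums_splitn xpos xsum k b bc).1 Eb.
have y2k := subsums_le xpos xsum (tlm k bc) H2.
have y20 := subsums_ge0 xpos xsum (tlm k bc) H2.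
have := gapb y1 (subsumsW (headn_le k c) H1) ltac:(lra).
by move=> by1; rewrite (_ : b = y1)//; lra.
Qed.

(** * The case of an interval starting at 0 *)

Section IntervalAtZero.
Variable d : R.
Hypothesis d0 : 0 < d.
Hypothesis Ed : forall z, 0 <= z < d -> subsums x (fun=> m) z.

Let small : nat -> nat := fun i => if x i < d then m else 0%N.
Let big : nat -> nat := fun i => if x i < d then 0%N else m.

Let sm : bounded_by m small. Proof. by move=> i; rewrite /small; case: ifP. Qed.
Let bm : bounded_by m big. Proof. by move=> i; rewrite /big; case: ifP. Qed.

(* The right end b of a gap is a finite sum. Trading one copy of the smallest
   term x_i it uses for the sums that fill [0, x_i[, which only involve terms
   smaller than x_i, covers [b - x_i, b[. *)
Lemma subsums_small_interval t : 0 <= t <= subsum x small -> subsums x small t.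
Proof.
move=> /andP[t0 tL]; have cl := subsums_closed xpos xsum sm.
have [b [Eb tb bmin]] := closed_next cl (subsums_max x small) tL.
have [<-//|tneb] := eqVneq b t; have {}tb : t < b by rewrite lt_neqAle eq_sym tneb.
have [k /(_ k (leqnn k)) [e [ek bE]]] :=
  subsums_gap_right sm Eb tb (fun z Ez tz => bmin z Ez (ltW tz)).
have es i : (e i <= small i)%N by exact: leq_trans (ek i) (headn_le _ _ _).
have em : bounded_by m e := bounded_le sm es.
have ebig i : (k <= i)%N -> e i = 0%N.
  by move=> ki; have := ek i; rewrite /headn ltnNge ki leqn0 => /eqP.
(* Some term is used, because [b > t >= 0]. *)
have [i0 ei0] : exists i : 'I_k, (0 < e i)%N.
  apply: contrapT => /forallNP H; move: tb; rewrite bE.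
  rewrite (_ : e = fun=> 0%N); first by rewrite subsum0; lra.
  apply/funext => i; have [/ebig//|ik] := leqP k i.
  by apply/eqP; rewrite -leqn0 leqNgt; apply/negP; exact: (H (Ordinal ik)).
case: (@arg_minP _ R 'I_k i0 (fun i => (0 < e i)%N) (fun i => x i) ei0) => i ei imin.
have xid : x i < d.
  by have := leq_trans ei (es i); rewrite /small; case: ifP.
have xi0 := xpos i.
have fill z : 0 <= z < x i -> subsums x small (b - x i + z).
  move=> /andP[z0 zx]; have [|e' [e'm zE]] := Ed (z := z); first by lra.
  (* A term at least [x i] would already exceed [z]. *)
  have e'0 j : x i <= x j -> e' j = 0%N.
    move=> xij; apply/eqP; rewrite -leqn0 leqNgt; apply/negP => ej.
    have := subsum_ge_term xpos xsum j e'm; rewrite -zE.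
    have : x j <= (e' j)%:R * x j by rewrite ler_peMl ?ler1n// ltW.
    by lra.
  pose e1 j := (e j - if j == nat_of_ord i then 1 else 0)%N.
  have e1m : bounded_by m e1 by apply: (bounded_le em) => j; exact: leq_subr.
  have dm : bounded_by m (fun j => if j == nat_of_ord i then 1%N else 0%N).
    by apply: (bounded_le em) => j; case: eqVneq => // ->.
  have e1E : b = subsum x e1 + x i.
    rewrite bE -subsum_delta1 -(subsumD xpos xsum e1m dm).
    congr subsum; apply/funext => j; rewrite /e1 subnK//.
    by case: eqVneq => [->|].
  exists (fun j => e1 j + e' j)%N; split; last first.
    by rewrite (subsumD xpos xsum e1m e'm) -zE e1E addrK.
  (* No index is overloaded: where [e] vanishes, [e'] alone counts; where it does not, [x j >= x i]
     by minimality and [e' j = 0]. *)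
  move=> j; have [ej|ej] := posnP (e j).
    rewrite /e1 ej sub0n add0n /small; case: ifP => [_|/negbT]; first exact: e'm.
    by rewrite -leNgt => dxj; rewrite e'0// ltW// (lt_le_trans xid).
  have jk : (j < k)%N by rewrite ltnNge; apply/negP => /ebig ej'; rewrite ej' in ej.
  rewrite e'0 ?addn0; last exact: (imin (Ordinal jk)).
  exact: leq_trans (leq_subr _ _) (es j).
(* Either [t] is in the covered interval, or [b - x i] is a sum above [t] and below [b], against the
   choice of [b]. *)
have [btx|tbx] := leP (b - x i) t.
  have := fill (t - (b - x i)) ltac:(lra).
  by rewrite addrCA subrr addr0.
have := bmin _ (fill 0 ltac:(lra)) ltac:(lra); lra.
Qed.

(** Only finitely many terms are at least [d], so the big terms have finitely many sums; each is the
    left end of a translate of the interval filled by the small terms. *)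
Lemma subsums_finite_union : (0 < m)%N -> finite_union_intervals (subsums x (fun=> m)).
Proof.
move=> m0; have [k Hk] := summable_term_lt xsum d0.
have finb : finite_set (subsums x big).
  by apply: (@subsums_finite _ _ _ k) => // i /Hk xi; rewrite /big xi.
have L0 : 0 < subsum x small.
  have := subsum_ge_term xpos xsum k sm; apply: lt_le_trans.
  by rewrite /small Hk// mulr_gt0// ltr0n.
have /finite_seqP[s sE] := finb.
have sP y : subsums x big y <-> exists2 i, (i < size s)%N & y = nth 0 s i.
  rewrite sE; split=> [/(nthP 0)[i si <-]|[i si ->]]; first by exists i.
  exact: mem_nth.
exists (size s), (fun i => nth 0 s i), (fun i => nth 0 s i + subsum x small).
split; first by have /sP[i si _] := subsums0 x big; exact: leq_ltn_trans si.
split; first by move=> i _; rewrite ltrDl.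
have E : (fun i => big i + small i)%N = (fun=> m).
  by apply/funext => i; rewrite /big /small; case: ifP; rewrite ?addn0.
have spl y := @subsumsD _ x m xpos xsum big small y.
rewrite E in spl; apply/seteqP; split=> [y /(spl _ cm).1|y [i /= si]].
  move=> [y1 [y2 [/sP[i si ->] H2 ->]]]; exists i => //=.
  rewrite in_itv/= lerDl lerD2l (subsums_ge0 xpos xsum sm H2).
  exact: (subsums_le xpos xsum sm H2).
rewrite in_itv/= => yi; apply/(spl _ cm); exists (nth 0 s i), (y - nth 0 s i).
split; [by apply/sP; exists i| |by rewrite addrC subrK].
by apply: subsums_small_interval; lra.
Qed.

End IntervalAtZero.

(** An interval in one tail is covered by finitely many closed translates of the next tail, so one
    of these contains an interval. *)
Lemma tail_has_interval k : has_interval (subsums x (fun=> m)) ->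
  has_interval (subsums x (tailn k (fun=> m))).
Proof.
elim: k => [//|k IH /IH[p [q [pq pqE]]]].
have [||j _ [p' [q' [pq' pqE']]]] := @closed_bigcup_interval _ (fun j =>
    (fun z => z - j%:R * x k) @^-1` subsums x (tailn k.+1 (fun=> m))) m.+1 p q _ pq.
- move=> j; apply: preimage_closed; last exact: (subsums_closed xpos xsum (tlm _ cm)).
  by move=> z _; apply: cvgB; [exact: cvg_id|exact: cvg_cst].
- move=> z zpq; have [j [jm Hj]] := (subsums_tailS xpos xsum _ _ cm).1 (pqE z zpq).
  by exists j.
exists (p' - j%:R * x k), (q' - j%:R * x k); split; first by rewrite ltrD2r.
move=> z; rewrite /= in_itv/= => zpq.
have := pqE' (z + j%:R * x k); rewrite /= in_itv/= addrK; apply; lra.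
Qed.

(** * The case of intervals, but none starting at 0 *)

Section NoIntervalAtZero.
Hypothesis Ei : has_interval (subsums x (fun=> m)).
Hypothesis E0 : forall d, 0 < d -> exists t, 0 < t < d /\ ~ subsums x (fun=> m) t.

(* Among the finitely many sums of the first k terms, only b itself can be
   completed to a sum just to the right of b, so there the set looks like b plus
   the sums of the remaining terms. *)
Lemma near_right_gap a b : subsums x (fun=> m) b -> a < b ->
  (forall z, a < z < b -> ~ subsums x (fun=> m) z) ->
  near_right (subsums x (fun=> m)) b.
Proof.
move=> Eb ab gapab e e0.
have gapb z : subsums x (fun=> m) z -> a < z -> b <= z.
  by move=> Ez az; rewrite leNgt; apply/negP => zb; apply: (gapab z) Ez; lra.
have [k0 Hk0] := subsums_gap_right cm Eb ab gapb.
(* A tail below [e] keeps the construction within [e] of [b]; below [b - a], it forces the head of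
   any sum beyond [b] to be above [a], hence at least [b]. *)
have mpos : 0 < Num.min e (b - a) by rewrite lt_min e0 subr_gt0.
have [k1 Hk1] := subsum_tail_lt xpos xsum cm mpos.
pose k := maxn k0 k1.
have bk : subsums x (headn k (fun=> m)) b by apply: Hk0; exact: leq_maxl.
have := Hk1 k (leq_maxr _ _); rewrite lt_min => /andP[rke rkab]; split.
  (* No head sum lies strictly between [b] and [b + r]. *)
  have [||r r0 Hr] := @finite_pos_lbound _ _ _ (fun f r => b < f -> b + r <= f)
    (subsums_headn_finite x k cm).
  - by move=> f r s sr h /h; lra.
  - move=> f _; have [bf|fb] := ltP b f; first by exists (f - b); lra.
    by exists 1 => //; lra.
  have [|t [tr Et]] := E0 (d := Num.min r e); first by rewrite lt_min r0.
  move: tr; rewrite lt_min => tr; exists (b + t); split; first by lra.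
  move=> /(subsums_splitn xpos xsum k _ cm)[f [g [Hf Hg fg]]].
  have g0 := subsums_ge0 xpos xsum (tlm k cm) Hg.
  have gr := subsums_le xpos xsum (tlm k cm) Hg.
  have bf := gapb f (subsumsW (headn_le k _) Hf) ltac:(lra).
  have [bltf|fb] := ltP b f; first by have := Hr f Hf bltf; lra.
  apply: Et; rewrite (_ : t = g); first exact: (subsumsW (tailn_le k _) Hg).
  by lra.
have [p [q [pq pqE]]] := tail_has_interval k Ei.
have Hp : subsums x (tailn k (fun=> m)) p by apply: pqE; rewrite /= in_itv/=; lra.
have Hq : subsums x (tailn k (fun=> m)) q by apply: pqE; rewrite /= in_itv/=; lra.
have p0 := subsums_ge0 xpos xsum (tlm k cm) Hp.
have qr := subsums_le xpos xsum (tlm k cm) Hq.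
(* The midpoint replaces [p], which may be 0, to stay strictly to the right of [b]. *)
exists (b + (p + q) / 2), (b + q); split; do ?lra.
move=> z; rewrite /= in_itv/= => zpq; apply/(subsums_splitn xpos xsum k _ cm).
exists b, (z - b); split=> //; last by rewrite addrC subrK.
by apply: pqE; rewrite /= in_itv/=; lra.
Qed.

(** The reflection [z] to [S - z] preserves the set and exchanges the two sides of a gap. *)
Lemma near_left_gap a b : subsums x (fun=> m) a -> a < b ->
  (forall z, a < z < b -> ~ subsums x (fun=> m) z) ->
  near_left (subsums x (fun=> m)) a.
Proof.
move=> Ea ab gapab e e0; pose S := subsum x (fun=> m).
have sym z : subsums x (fun=> m) z -> subsums x (fun=> m) (S - z).
  exact: (subsums_sym xpos xsum cm).
have symN z : ~ subsums x (fun=> m) z -> ~ subsums x (fun=> m) (S - z).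
  by move=> Ez /sym; rewrite opprB addrC subrK.
have gap' z : S - b < z < S - a -> ~ subsums x (fun=> m) z.
  move=> zab Ez; apply: (gapab (S - z)); [lra|exact: sym].
have Sab : S - b < S - a by rewrite ltrD2l ltrN2.
have [] := near_right_gap (sym _ Ea) Sab gap' e0.
move=> [t [tS /symN Et]] [p [q [Sp pq qS pqE]]]; split.
  by exists (S - t); split; first by lra.
exists (S - q), (S - p); split; do ?lra.
move=> z; rewrite /= in_itv/= => zpq; rewrite -[z](subKr S); apply: sym.
by apply: pqE; rewrite /= in_itv/=; lra.
Qed.

Lemma subsums_M_cantorval : (0 < m)%N -> M_cantorval (subsums x (fun=> m)).
Proof.
move=> m0; split=> [|G gG]; first exact: subsums_perfect.
have [ab Ka Kb gapab] := gap_endpoints (subsums_closed xpos xsum cm) gG.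
split; first exact: near_left_acc (near_left_gap Ka ab gapab).
exact: near_right_acc (near_right_gap Kb ab gapab).
Qed.

End NoIntervalAtZero.

End Trichotomy.

(** * The middle-thirds set and the interval-free case *)

Section MiddleThirds.
Context {R : realType}.

(** Each tail falls into two pieces separated by a hole, so an interval lies in one piece and
    descends to the next tail with its length intact; but the tails shrink to 0. *)
Lemma tail_lt_no_interval (y : R ^nat) : (forall n, 0 < y n) -> cvgn (series y) ->
  (forall k, subsum y (tailn k.+1 (fun=> 1%N)) < y k) ->
  ~ has_interval (subsums y (fun=> 1%N)).
Proof.
move=> ypos ysum fast [p [q [pq pqE]]].
have cm : bounded_by 1 (fun=> 1%N) by [].
have tm k : bounded_by 1 (tailn k (fun=> 1%N)).
  by apply: (bounded_le cm); exact: tailn_le.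
have step k : exists p', forall z, p' <= z <= p' + (q - p) ->
    subsums y (tailn k (fun=> 1%N)) z.
  elim: k => [|k [p' IH]].
    by exists p => z zpq; apply: pqE; rewrite /= in_itv/=; lra.
  have := fast k; set r := subsum _ _ => rk.
  have dich z : p' <= z <= p' + (q - p) ->
      subsums y (tailn k.+1 (fun=> 1%N)) z /\ z <= r \/
      subsums y (tailn k.+1 (fun=> 1%N)) (z - y k) /\ y k <= z.
    move=> /IH/(subsums_tailS ypos ysum _ _ cm)[j [j1 Hj]].
    have Hj0 := subsums_ge0 ypos ysum (tm _) Hj.
    have Hjr := subsums_le ypos ysum (tm _) Hj; rewrite -/r in Hjr.
    case: j j1 Hj Hj0 Hjr => [|[|//]] _; rewrite ?mul0r ?subr0 ?mul1r => Hj *; first by left.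
    by right; split=> //; lra.
  have [p'r|rp'] := leP p' r.
    (* Starting at or below [r], the interval cannot reach [y k], or it would contain the midpoint
       of the hole []r, y k[]. *)
    exists p' => z zp; have [[//]|[_ ykz]] := dich z zp.
    have [|[_]|[_]] := dich ((r + y k) / 2); lra.
  (* Starting above [r], it lies entirely in the upper piece, which is the next tail shifted by
     [y k]. *)
  exists (p' - y k) => z zp.
  have [|[_]|[]] := dich (z + y k); [lra|lra|].
  by rewrite addrK.
have qp0 : 0 < q - p by lra.
have [k /(_ k (leqnn k)) kqp] := subsum_tail_lt ypos ysum cm qp0.
have [p' Hp'] := step k.
have H1 := subsums_ge0 ypos ysum (tm k) (Hp' p' ltac:(lra)).
have H2 := subsums_le ypos ysum (tm k) (Hp' (p' + (q - p)) ltac:(lra)).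
by lra.
Qed.

Let thirds : R ^nat := fun i => 2 / 3 ^+ i.+1.

Let thirds_gt0 n : 0 < thirds n.
Proof. by rewrite divr_gt0// exprn_gt0. Qed.

Let thirds_series : series thirds = fun n => 1 - (3^-1) ^+ n.
Proof.
apply/funext; elim=> [|n IH]; first by rewrite /series/= big_geq// expr0 subrr.
rewrite seriesSr IH /thirds -exprVn exprS.
by set u := _ ^+ n; lra.
Qed.

Let thirds_cvg : series thirds @ \oo --> (1 : R).
Proof.
rewrite thirds_series -[X in _ --> X]subr0; apply: cvgB; first exact: cvg_cst.
by apply: cvg_expr; rewrite ger0_norm; lra.
Qed.

Let thirds_sum : cvgn (series thirds).
Proof. exact: (cvgP _ thirds_cvg). Qed.

(** Makes compactness and perfectness of sets of sums available for the middle-thirds set, as the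
    case of coefficients 0 and 1. *)
Lemma middle_thirdsE : @middle_thirds_cantor R = subsums thirds (fun=> 1%N).
Proof.
have E (d : nat -> nat) (b : nat -> bool) : (forall i, d i = b i) ->
    limn (series (fun i => (2 * (b i)%:R) / 3 ^+ i.+1 : R)) = subsum thirds d.
  move=> db; congr (limn (series _)); apply/funext => i.
  by rewrite /thirds db mulrA [2 * _]mulrC.
apply/seteqP; split=> [_ [d ->]|_ [e [e1 ->]]].
  exists (fun i => nat_of_bool (d i)); split; first by move=> i; case: (d i).
  exact: E.
exists (fun i => e i == 1%N); apply/esym/E => i.
by case: (e i) (e1 i) => [|[|]].
Qed.

(** The terms after the k-th add up to [3 ^- k.+1], half of the k-th term. *)
Lemma middle_thirds_no_interval : ~ has_interval (@middle_thirds_cantor R).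
Proof.
rewrite middle_thirdsE; apply: tail_lt_no_interval => // k.
have b1 : bounded_by 1 (fun=> 1%N) by [].
have oneE : (fun i => 1%:R * thirds i) = thirds.
  by apply/funext => i; rewrite mul1r.
have totE : subsum thirds (fun=> 1%N) = 1.
  by rewrite /subsum oneE (cvg_lim _ thirds_cvg).
have := subsum_splitn thirds_gt0 thirds_sum k.+1 b1.
rewrite totE subsum_headE oneE thirds_series /thirds -exprVn.
have : 0 < (3^-1 : R) ^+ k.+1 by rewrite exprn_gt0// invr_gt0.
by lra.
Qed.

Lemma Em_cantor_set (x : R ^nat) m : (forall n, 0 < x n) ->
  cvgn (series x) -> (0 < m)%N -> ~ has_interval (Em m x) -> cantor_set (Em m x).
Proof.
move=> xpos xsum m0 noint.
have bm : bounded_by m (fun=> m) by [].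
have b1 : bounded_by 1 (fun=> 1%N) by [].
apply: homeomorphic_cantor => //.
- by exists 0; exact: subsums0.
- exact: (subsums_compact xpos xsum bm).
- exact: subsums_perfect.
- by rewrite middle_thirdsE; exists 0; exact: subsums0.
- by rewrite middle_thirdsE; exact: (subsums_compact thirds_gt0 thirds_sum b1).
- by rewrite middle_thirdsE; exact: subsums_perfect.
- exact: middle_thirds_no_interval.
Qed.

End MiddleThirds.

(** * Assembly of the three cases *)

Lemma homeomorphic_refl (R : realType) (A : set R) : homeomorphic A A.
Proof.
exists id, id; split=> //; do ?by move=> _ [a Aa <-].
by split; apply: continuous_subspaceT => y; exact: cvg_id.
Qed.

Theorem theorem11 (R : realType) (x : R ^nat)
  (xpos : forall n, 0 < x n) (xsum : cvgn (series x)) (m : nat) (m_pos : (0 < m)%N) :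
  [\/ cantor_set (Em m x),
      (exists A, finite_union_intervals A /\ homeomorphic (Em m x) A)
    | (exists C, cantorval C /\ homeomorphic (Em m x) C)].
Proof.
have [Ei|noint] := pselect (has_interval (Em m x)); last first.
  by apply: Or31; exact: Em_cantor_set.
have [[d [d0 Ed]]|noE0] := pselect (exists d, 0 < d /\
    forall z, 0 <= z < d -> Em m x z).
  apply: Or32; exists (Em m x); split; last exact: homeomorphic_refl.
  exact: (subsums_finite_union xpos xsum d0 Ed).
apply: Or33; exists (Em m x); split; last exact: homeomorphic_refl.
apply: Or31; apply: subsums_M_cantorval => // d d0; apply: contrapT => /forallNP H.
apply: noE0; exists d; split=> // z /andP[]; rewrite le_eqVlt.
(* The point 0 is always a sum, so a missing point of [[0, d[] is positive. *)
move=> /predU1P[<- _|z0 zd]; first exact: subsums0.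
by apply: contrapT => Ez; apply: (H z); rewrite z0.
Qed.
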